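(* (a) Let $\mathcal M$ be the Polish space of Polish (i.e. separable complete) metric spaces of diameter at most $1$. For every Polish metric space $A$ of diameter at most $1$, the set $\{B\in\mathcal M: d_{\mathrm{GH}}(A,B)=0\}$ of Polish metric spaces whose Gromov–Hausdorff distance to $A$ is $0$ is Borel. (b) Let $\mathcal B$ be the standard Borel space of separable Banach spaces. For every separable Banach space $A$, the set $\{B\in\mathcal B: d_{\mathrm K}(A,B)=0\}$ of separable Banach spaces whose Kadets distance to $A$ is $0$ is Borel.
   Context: Distances. For closed subsets $A,B$ of a metric space $(C,d)$, the Hausdorff distance is $d_{\mathrm H}(A,B)=\max\bigl(\sup_{x\in A}d(x,B),\sup_{y\in B}d(y,A)\bigr)$. For metric spaces $A,B$, $d_{\mathrm{GH}}(A,B)=\inf_{f_1,f_2}d_{\mathrm H}(f_1(A),f_2(B))$ over all isometric embeddings $f_1,f_2$ of $A,B$ into a third metric space $C$. For (real) Banach spaces $A,B$ with unit balls $\mathcal B_A,\mathcal B_B$, $d_{\mathrm K}(A,B)=\inf_{f_1,f_2}d_{\mathrm H}(f_1(\mathcal B_A),f_2(\mathcal B_B))$ over all linear isometric embeddings $f_1,f_2$ of $A,B$ into a third Banach space $C$. Coding. A sequence $(a_i)_{i\in\mathbb N}$ in a metric space $A$ is tail-dense if $\{a_i:i>k\}$ is dense in $A$ for every $k$. (a) $\mathcal M$ is the set of all $p\in\mathbb R^{\mathbb N\times\mathbb N}$ for which there are a separable complete metric space $A$ of diameter at most $1$ and a tail-dense sequence $(a_i)$ in $A$ with $p(i,j)=d(a_i,a_j)$;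 it is a $G_\delta$ subset of $\mathbb R^{\mathbb N\times\mathbb N}$, and $p$ is identified with the space $A$. (b) Separable Banach spaces are regarded as structures with distance $d(x,y)=\min(\|x-y\|,1)$, a constant $0$, addition, multiplications $M_\lambda$ by rational scalars $\lambda$, and predicates $\|x\|_n=\min(\|x\|,n)$, $n\ge1$. A separable Banach space $A$ with a tail-dense sequence $(a_i)$ is coded by the values of $d(a_i,a_j)$, $\|a_i\|_n$, $d(0,a_j)$, $d(a_i+a_j,a_k)$ and $d(M_\lambda a_i,a_j)$ for all indices; the set $\mathcal B$ of all such codes is a Borel subset of the product of countably many copies of $\mathbb R$, and a code is identified with the Banach space $A$. *)

(* Defs.v *)
From HB Require Import structures.
From mathcomp Require Import all_boot all_order all_algebra.
From mathcomp Require Import all_classical all_reals all_analysis.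

Set Implicit Arguments.
Unset Strict Implicit.
Unset Printing Implicit Defensive.

Import Order.TTheory GRing.Theory Num.Theory.
Import numFieldNormedType.Exports.

Local Open Scope classical_set_scope.
Local Open Scope ring_scope.

Section Topology.
Context {T : topologicalType}.

Definition borel : set_system T := <<s open >>.

Definition separable : Prop := exists2 D : set T, countable D & dense D.

Definition tail_dense (a : nat -> T) : Prop :=
  forall k : nat, dense [set a i | i in [set i | (k < i)%N]].

End Topology.
Arguments separable T : clear implicits.

(* The library's completeType is pointed, hence cannot be used for metric
   spaces that may be empty. *)
Definition complete_space (T : uniformType) : Prop :=
  forall F : set_system T, ProperFilter F -> cauchy F -> exists l : T, F --> l.

Section Distances.
Context {R : realType}.

(* [edist (x, y)] is the infimum of the radii [r > 0] with [ball x r y], i.e.,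
   the distance from x to y in metric spaces and in normed modules, and
   [edist_inf S x] is the distance from the point x to the set S. *)
Definition hausdorff_dist {C : pseudoMetricType R} (S T : set C) : \bar R :=
  maxe (ereal_sup [set edist_inf T x | x in S])
       (ereal_sup [set edist_inf S y | y in T]).

Definition isometric {A C : metricType R} (f : A -> C) : Prop :=
  forall x y, mdist (f x) (f y) = mdist x y.

Definition gromov_hausdorff_dist (A B : metricType R) : \bar R :=
  ereal_inf [set r | exists (C : metricType R) (f1 : A -> C) (f2 : B -> C),
    [/\ isometric f1, isometric f2 &
        r = hausdorff_dist (range f1) (range f2)]].

Definition unit_ball (V : normedModType R) : set V := [set x | `|x| <= 1].
Arguments unit_ball : clear implicits.

Definition kadets_dist (A B : completeNormedModType R) : \bar R :=
  ereal_inf [set r | exists (C : completeNormedModType R)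
      (f1 : {linear A -> C}) (f2 : {linear B -> C}),
    [/\ forall x, `|f1 x| = `|x|, forall y, `|f2 y| = `|y| &
        r = hausdorff_dist (f1 @` unit_ball A) (f2 @` unit_ball B)]].

End Distances.

Section MetricCodes.
Context {R : realType}.

Definition polish_metric (A : metricType R) : Prop :=
  separable A /\ complete_space A.

Definition diameter_le1 (A : metricType R) : Prop :=
  forall x y : A, mdist x y <= 1.

Definition metric_code {A : metricType R} (a : nat -> A) :
    {ptws nat * nat -> R} :=
  fun ij => mdist (a ij.1) (a ij.2).

Definition codes_metric (p : {ptws nat * nat -> R}) (A : metricType R) : Prop :=
  [/\ polish_metric A, diameter_le1 A &
      exists2 a : nat -> A, tail_dense a & p = metric_code a].

End MetricCodes.

(* Coerced to a type, this is the space of codes with the topology induced by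
   the product topology; likewise for [banach_codes] below. *)
Definition metric_codes (R : realType) : set {ptws nat * nat -> R} :=
  [set p | exists A : metricType R, codes_metric p A].
Arguments metric_codes : clear implicits.

(* [bnorm n i] stands for the predicate of index n.+1 >= 1. *)
Inductive banach_index : Type :=
  | bdist of nat & nat
  | bnorm of nat & nat
  | bzero of nat
  | badd of nat & nat & nat
  | bscale of rat & nat & nat.

Section BanachCodes.
Context {R : realType}.

Definition truncated_dist {V : normedModType R} (x y : V) : R :=
  Num.min `|x - y| 1.

Definition banach_code {V : normedModType R} (a : nat -> V) :
    {ptws banach_index -> R} :=
  fun c => match c with
  | bdist i j => truncated_dist (a i) (a j)
  | bnorm n i => Num.min `|a i| n.+1%:R
  | bzero j => truncated_dist 0 (a j)
  | badd i j k => truncated_dist (a i + a j) (a k)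
  | bscale l i j => truncated_dist (ratr l *: a i) (a j)
  end.

Definition codes_banach (q : {ptws banach_index -> R})
    (V : completeNormedModType R) : Prop :=
  separable V /\ exists2 a : nat -> V, tail_dense a & q = banach_code a.

End BanachCodes.

Definition banach_codes (R : realType) : set {ptws banach_index -> R} :=
  [set q | exists V : completeNormedModType R, codes_banach q V].
Arguments banach_codes : clear implicits.

(* Main.v *)
(* Scott analysis in the style of continuous logic. Write A and B through dense
   sequences. Two finite tuples are e-matched at stage 0 if their atomic
   diagrams (distances, resp. norms of rational linear combinations) differ by
   at most e, and at stage T+1 if every one-point extension on either side is
   (e + d)-matched at stage T for every d > 0. For fixed T, tuples and e, this
   is a Borel condition on the code of B. By countability there is a stage T at
   which the relation between A and itself is already the limit one. Then
   d(A, B) = 0 iff the empty tuples are 0-matched at stage T and matching at T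
   implies matching at T+1 between A and B. If d(A, B) = 0, a tuple of B is
   almost perfectly matched, at all stages, with some tuple of A, and the
   triangle inequality transports the stabilization from A, A to A, B.
   Conversely, under the Borel condition a back-and-forth construction yields,
   for every e > 0, an e-correspondence of the dense sequences, which is turned
   into a pair of embeddings: into a space of sequences with the supremum metric
   in the metric case, and into A x B with a suitable norm in the Banach case. *)
Require Import Defs.
From HB Require Import structures.
From mathcomp Require Import all_boot all_order all_algebra.
From mathcomp Require Import all_classical all_reals all_analysis.
From mathcomp Require Import lra.
Import Order.TTheory GRing.Theory Num.Theory.
Import numFieldNormedType.Exports.
Local Open Scope classical_set_scope.
Local Open Scope ring_scope.

Set Implicit Arguments.
Unset Strict Implicit.
Unset Printing Implicit Defensive.

(** * The Scott analysis *)

Section SigmaAlgebra.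
Context {X : Type} {S : set_system X} (sigS : sigma_algebra setT S).

Lemma sigma_algebra_not (P : X -> Prop) :
  S [set q | P q] -> S [set q | ~ P q].
Proof. by case: sigS => _ SC _ /SC; rewrite setTD. Qed.

Lemma sigma_algebra_ex {I : countType} {P : I -> X -> Prop} :
  (forall i, S [set q | P i q]) -> S [set q | exists i, P i q].
Proof.
case: sigS => S0 _ SU SP.
have := SU (fun n => [set q | if unpickle n is Some i then P i q else False]).
have -> : \bigcup_n [set q | if unpickle n is Some i then P i q else False]
    = [set q | exists i, P i q].
  apply/seteqP; split=> [q [n _] /=|q [i Piq]]; last first.
    by exists (pickle i) => //=; rewrite pickleK.
  by case: (unpickle n) => [i|//]; exists i.
apply=> n; case: (unpickle n) => [i|]; first exact: SP.
by have -> : [set q : X | False] = set0 by apply/seteqP; split.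
Qed.

Lemma sigma_algebra_all {I : countType} {P : I -> X -> Prop} :
  (forall i, S [set q | P i q]) -> S [set q | forall i, P i q].
Proof.
move=> SP; have -> : [set q | forall i, P i q] = [set q | ~ exists i, ~ P i q].
  apply/seteqP; split=> [q Pq [i]|q /= nP i]; first exact.
  by apply: contrapT => nPi; apply: nP; exists i.
by apply: sigma_algebra_not; apply: sigma_algebra_ex => i; apply: sigma_algebra_not.
Qed.

Lemma sigma_algebra_and (P Q : X -> Prop) :
  S [set q | P q] -> S [set q | Q q] -> S [set q | P q /\ Q q].
Proof.
move=> SP SQ; have -> : [set q | P q /\ Q q]
    = [set q | forall b : bool, if b then P q else Q q].
  apply/seteqP; split=> [q [Pq Qq] []//|q PQ].
  by split; [exact: (PQ true)|exact: (PQ false)].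
by apply: sigma_algebra_all => -[].
Qed.

Lemma sigma_algebra_or (P Q : X -> Prop) :
  S [set q | P q] -> S [set q | Q q] -> S [set q | P q \/ Q q].
Proof.
move=> SP SQ; have -> : [set q | P q \/ Q q]
    = [set q | exists b : bool, if b then P q else Q q].
  apply/seteqP; split=> [q [Pq|Qq]|q [[] ?]]; [exists true|exists false|left|right] => //.
by apply: sigma_algebra_ex => -[].
Qed.

Lemma sigma_algebra_imply (P Q : X -> Prop) :
  S [set q | P q] -> S [set q | Q q] -> S [set q | P q -> Q q].
Proof.
move=> SP SQ; have -> : [set q | P q -> Q q] = [set q | ~ P q \/ Q q].
  by apply/funext => q /=; rewrite implyE.
by apply: sigma_algebra_or => //; exact: sigma_algebra_not.
Qed.

Lemma sigma_algebra_cst (P : Prop) : S [set q : X | P].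
Proof.
have S0 : S [set q : X | False] by case: sigS => S0 _ _; exact: S0.
case: (pselect P) => HP; last by have -> : P = False by apply/propext; split.
have -> : P = (~ False) by apply/propext; split=> // _ [].
exact: sigma_algebra_not.
Qed.

End SigmaAlgebra.

Lemma ratr_between {R : realType} {x y : R} :
  x < y -> exists r : rat, x < ratr r < y.
Proof. by move=> /rat_in_itvoo[r]; rewrite in_itv /=; exists r. Qed.

(* Well-founded countably branching trees play the role of the countable
   ordinals. *)
Inductive stage := stage0 | stage_sup of nat -> stage.

(** [stage_sup f] is the least stage above every [f n], so a constant family gives the successor. *)
Definition stage_succ (T : stage) := stage_sup (fun=> T).

Section Scott.
Context {R : realType} {Theta : countType} (w : Theta -> R).
Hypothesis w_ge0 : forall t, 0 <= w t.

Implicit Types (x y z : Theta -> seq nat -> R) (a b c : seq nat) (d e : rat).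
Implicit Types (T : stage).

(** Here [x t a] is the value of the test [t] on the tuple [a], and [w t] scales the error allowed
    for [t]. The first conjunct makes each stage refine the ones below it; the slack [d] is there
    because a dense sequence answers a move only approximately. *)
Fixpoint bf_close T x y a b e : Prop :=
  match T with
  | stage0 => forall t, `|x t a - y t b| <= ratr e * w t
  | stage_sup f => forall n, bf_close (f n) x y a b e /\ forall d, 0 < d ->
      (forall i, exists j, bf_close (f n) x y (rcons a i) (rcons b j) (e + d)) /\
      (forall j, exists i, bf_close (f n) x y (rcons a i) (rcons b j) (e + d))
  end.

Lemma bf_close_sym T x y a b e : bf_close T x y a b e -> bf_close T y x b a e.
Proof.
elim: T a b e => [|f IH] a b e /=; first by move=> H t; rewrite distrC.
move=> H n; have [H1 H2] := H n; split; first exact: IH.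
move=> d d0; have [Hl Hr] := H2 d d0; split=> i.
- by have [j /IH ?] := Hr i; exists j.
- by have [j /IH ?] := Hl i; exists j.
Qed.

Lemma bf_close_trans T x y z a b c e d :
  bf_close T x y a b e -> bf_close T y z b c d -> bf_close T x z a c (e + d).
Proof.
elim: T a b c e d => [|f IH] a b c e d /=.
  move=> H1 H2 t; rewrite rmorphD /= mulrDl.
  by rewrite (le_trans (ler_distD (y t b) _ _))// lerD.
move=> H1 H2 n; have [H1n H1'] := H1 n; have [H2n H2'] := H2 n.
split; first exact: IH H1n H2n.
move=> r r0; have r20 : 0 < r / 2 by rewrite divr_gt0.
have eE : e + d + r = (e + r / 2) + (d + r / 2) by lra.
have [l1 r1] := H1' _ r20; have [l2 r2] := H2' _ r20; rewrite eE; split=> i.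
- by have [j Hj] := l1 i; have [k Hk] := l2 j; exists k; exact: IH Hj Hk.
- by have [j Hj] := r2 i; have [k Hk] := r1 j; exists k; exact: IH Hk Hj.
Qed.

(** The bound at stage 0 is a closed condition, and higher up half of the slack [d] absorbs the
    excess error. *)
Lemma bf_close_right_limit T x y a b e :
  (forall d, 0 < d -> bf_close T x y a b (e + d)) -> bf_close T x y a b e.
Proof.
elim: T a b e => [|f IH] a b e /= H.
  move=> t; rewrite leNgt; apply/negP => lt_d.
  (* If [w t = 0], the bound is 0 whatever the error, so the hypothesis at error 1 suffices. *)
  have [w0|w0] := eqVneq (w t) 0.
    by have := H 1 ltr01 t; rewrite leNgt w0 mulr0 -[X in X < _](mulr0 (ratr e)) -w0 lt_d.
  have wt : 0 < w t by rewrite lt_neqAle eq_sym w0 w_ge0.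
  have := lt_d; rewrite -ltr_pdivlMr// -subr_gt0 => /ratr_between[d /andP[d0 lt2]].
  have := H d; rewrite -(ltr_rat R) rmorph0 d0 => /(_ isT t).
  by rewrite leNgt -ltr_pdivlMr// rmorphD /= addrC -ltrBrDr lt2.
move=> n; split; first by apply: IH => d d0; have [] := H d d0 n.
move=> d d0; have d20 : 0 < d / 2 by rewrite divr_gt0.
have [_ /(_ _ d20)] := H _ d20 n.
by rewrite (_ : e + d / 2 + d / 2 = e + d)//; lra.
Qed.

(** Each of the countably many triples [(a, b, e)] that fail at some stage selects such a stage, and
    one stage lies above all those selected. *)
Lemma scott_stage x y : exists T, forall a b e,
  bf_close T x y a b e -> forall T', bf_close T' x y a b e.
Proof.
have /choice[f fP] : forall k : seq nat * seq nat * rat, exists T,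
    bf_close T x y k.1.1 k.1.2 k.2 -> forall T', bf_close T' x y k.1.1 k.1.2 k.2.
  move=> k; case: (pselect (forall T', bf_close T' x y k.1.1 k.1.2 k.2)) => [?|].
    by exists stage0.
  by move=> /existsNP[T nT]; exists T.
exists (stage_sup (fun n => if unpickle n is Some k then f k else stage0)).
move=> a b e /= /(_ (pickle (a, b, e))); rewrite pickleK => -[H _].
exact: (fP (a, b, e)).
Qed.

(** Matching at [T] implies matching at the successor of [T], so every answer leads again to tuples
    matched at [T] and the game never stops. *)
Lemma back_and_forth T x y :
    bf_close T x y [::] [::] 0 ->
    (forall a b e, bf_close T x y a b e -> bf_close (stage_succ T) x y a b e) ->
  forall e, 0 < e -> exists f g : nat -> nat,
    [/\ forall i, exists n, f n = i, forall j, exists n, g n = j &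
        forall n, bf_close stage0 x y (mkseq f n) (mkseq g n) e].
Proof.
move=> T0 TS e e0.
pose good (s : seq nat * seq nat * rat) := bf_close T x y s.1.1 s.1.2 s.2 /\ s.2 < e.
have step (ns : nat * (seq nat * seq nat * rat)) : exists t : nat * nat * rat,
    good ns.2 -> good (rcons ns.2.1.1 t.1.1, rcons ns.2.1.2 t.1.2, t.2) /\
      (if odd ns.1 then t.1.2 else t.1.1) = ns.1./2.
  case: ns => n [[a b] d]; rewrite /good /=.
  (* Other states receive a default move, which makes the choice function total. *)
  case: (pselect (bf_close T x y a b d /\ d < e)) => [[/TS H de]|]; last by exists (0%N, 0%N, 0).
  (* Spending half of the remaining error keeps the total below [e] forever. *)
  have r0 : 0 < (e - d) / 2 by rewrite divr_gt0// subr_gt0.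
  have [_ /(_ _ r0)[Hl Hr]] := H 0%N.
  have lt_e : d + (e - d) / 2 < e by lra.
  (* Odd rounds play the index [n./2] on the right and even rounds on the left, so both enumerations
     are onto. *)
  case: (odd n).
  - by have [i Hi] := Hr n./2; exists (i, n./2, d + (e - d) / 2).
  - by have [j Hj] := Hl n./2; exists (n./2, j, d + (e - d) / 2).
have [F FP] := choice step.
pose st := fix st n := if n is m.+1 then
   let s := st m in let t := F (m, s) in (rcons s.1.1 t.1.1, rcons s.1.2 t.1.2, t.2)
   else ([::], [::], 0 : rat).
have stG n : good (st n).
  elim: n => [//|n IH]; exact: (FP (n, st n) IH).1.
exists (fun n => (F (n, st n)).1.1), (fun n => (F (n, st n)).1.2); split.
- move=> i; exists i.*2; have [_] := FP (i.*2, st i.*2) (stG _).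
  by rewrite /= odd_double doubleK.
- move=> j; exists j.*2.+1; have [_] := FP (j.*2.+1, st j.*2.+1) (stG _).
  by rewrite /= odd_double /= uphalf_double.
move=> n; have [] := stG n.
have -> : (st n).1.1 = mkseq (fun n => (F (n, st n)).1.1) n.
  by elim: n => [//|n IH]; rewrite mkseqS -IH.
have -> : (st n).1.2 = mkseq (fun n => (F (n, st n)).1.2) n.
  by elim: n => [//|n IH]; rewrite mkseqS -IH.
move: (mkseq _ _) (mkseq _ _) (st n).2 => b a d H lt_de.
have {H} : bf_close stage0 x y a b d.
  by elim: T H {T0 TS good step F FP st stG} => [//|f IH] /= /(_ 0%N)[/IH].
by move=> /= H t; rewrite (le_trans (H t))// ler_wpM2r// ler_rat ltW.
Qed.

(** A relation total on both sides answers every one-point extension by a related pair, so the bound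
    at stage 0 persists at all stages. *)
Lemma bf_close_total_relation T x y (E : nat -> nat -> Prop) e (s : seq (nat * nat)) :
    (forall i, exists j, E i j) -> (forall j, exists i, E i j) ->
    (forall r : seq (nat * nat), {in r, forall p, E p.1 p.2} ->
      bf_close stage0 x y (unzip1 r) (unzip2 r) e) ->
  {in s, forall p, E p.1 p.2} -> bf_close T x y (unzip1 s) (unzip2 s) e.
Proof.
move=> El Er E0.
have mono a b d : bf_close stage0 x y a b e -> 0 < d -> bf_close stage0 x y a b (e + d).
  by move=> /= H d0 t; rewrite (le_trans (H t))// ler_wpM2r// ler_rat lerDl ltW.
(* The slack granted at each extension accumulates, so the induction treats all errors [e + d] at
   once. *)
suff {s} main d : 0 <= d -> forall s, {in s, forall p, E p.1 p.2} ->
    bf_close T x y (unzip1 s) (unzip2 s) (e + d).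
  by move=> Es; have := main 0 (lexx _) _ Es; rewrite addr0.
elim: T d => [|f IH] d d0 s Es.
  by move=> t; rewrite (le_trans (E0 _ Es t))// ler_wpM2r// ler_rat lerDl.
move=> n; split; first exact: IH.
move=> r r0; rewrite -addrA; have dr0 : 0 <= d + r by rewrite addr_ge0// ltW.
have Ercons i j : E i j -> {in rcons s (i, j), forall p, E p.1 p.2}.
  by move=> Eij p; rewrite mem_rcons in_cons => /predU1P[->|/Es].
split=> [i|j].
- have [j /Ercons Eij] := El i; exists j.
  by have := IH n _ dr0 _ Eij; rewrite /unzip1 /unzip2 !map_rcons.
- have [i /Ercons Eij] := Er j; exists i.
  by have := IH n _ dr0 _ Eij; rewrite /unzip1 /unzip2 !map_rcons.
Qed.

(** * Measurability of matching and the resulting Borel set *)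

Section Borel.
Context {X : Type} {S : set_system X} (sigS : sigma_algebra setT S).
Variables (x : Theta -> seq nat -> R) (F : X -> Theta -> seq nat -> R).
Hypothesis SF : forall t b r, S [set q | F q t b < r].

Lemma sigma_algebra_bf_close T a b e : S [set q | bf_close T x (F q) a b e].
Proof.
elim: T a b e => [|f IH] a b e /=.
  apply: (sigma_algebra_all sigS) => t.
  (* Only the sets [F q t b < r] are known to be measurable, so the non-strict upper bound becomes
     countably many strict ones. *)
  have -> : [set q | `|x t a - F q t b| <= ratr e * w t] =
      [set q | ~ (F q t b < x t a - ratr e * w t) /\
         forall n : nat, F q t b < x t a + ratr e * w t + n.+1%:R^-1].
    apply/seteqP; split=> q /=.
      rewrite ler_distlC => /andP[H1 H2]; split; first by apply/negP; rewrite -leNgt.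
      by move=> n; rewrite (le_lt_trans H2)// ltrDl invr_gt0.
    move=> [/negP]; rewrite -leNgt ler_distlC => -> H2 /=.
    apply/ler_addgt0Pr => r r0.
    have [n _ /(_ n (leqnn _)) /= nr] : \forall n \near \oo, n.+1%:R^-1 < r.
      exact: near_infty_natSinv_lt (PosNum r0).
    by rewrite (le_trans (ltW (H2 n)))// lerD2l ltW.
  apply: (sigma_algebra_and sigS); first exact: (sigma_algebra_not sigS).
  exact: (sigma_algebra_all sigS).
apply: (sigma_algebra_all sigS) => n.
apply: (sigma_algebra_and sigS) => //.
apply: (sigma_algebra_all sigS) => d.
apply: (sigma_algebra_imply sigS); first exact: sigma_algebra_cst.
apply: (sigma_algebra_and sigS);
  by apply: (sigma_algebra_all sigS) => i; apply: (sigma_algebra_ex sigS) => j.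
Qed.

(** The analysis in the form shared by both distances: [x] gives the tests of A, and [F q] those of
    the space coded by [q]. *)
Lemma scott_set : exists Y : set X, [/\ S Y,
  forall q, (forall e, 0 < e -> exists E : nat -> nat -> Prop,
      [/\ forall i, exists j, E i j, forall j, exists i, E i j &
          forall s : seq (nat * nat), {in s, forall p, E p.1 p.2} ->
            bf_close stage0 x (F q) (unzip1 s) (unzip2 s) e]) -> Y q &
  forall q, Y q -> forall e, 0 < e -> exists f g : nat -> nat,
    [/\ forall i, exists n, f n = i, forall j, exists n, g n = j &
        forall n, bf_close stage0 x (F q) (mkseq f n) (mkseq g n) e]].
Proof.
(* Taken between [x] and itself, the stage [T] does not depend on [q]. *)
have [T TP] := scott_stage x x.
exists [set q | bf_close T x (F q) [::] [::] 0 /\ forall abe : seq nat * seq nat * rat,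
  bf_close T x (F q) abe.1.1 abe.1.2 abe.2 ->
  bf_close (stage_succ T) x (F q) abe.1.1 abe.1.2 abe.2]; split.
- apply: (sigma_algebra_and sigS); first exact: sigma_algebra_bf_close.
  apply: (sigma_algebra_all sigS) => abe.
  by apply: (sigma_algebra_imply sigS); exact: sigma_algebra_bf_close.
- move=> q H; split.
    apply: bf_close_right_limit => d d0; rewrite add0r.
    have [E [El Er E0]] := H d d0.
    by have := bf_close_total_relation T (s := [::]) El Er E0; apply.
  move=> [[a b] e] Hab; apply: (@bf_close_right_limit (stage_succ T)) => d d0.
  have d20 : 0 < d / 2 by rewrite divr_gt0.
  have [E [El Er E0]] := H _ d20.
  (* The tuple [a'] is a copy of [b] on the side of [x], matched with [b] at all stages. *)
  have [h hP] := choice Er; pose a' := map h b.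
  have a'b T' : bf_close T' x (F q) a' b (d / 2).
    have := bf_close_total_relation T' (s := map (fun j => (h j, j)) b) El Er E0.
    rewrite /unzip1 /unzip2 -!map_comp /= map_id; apply.
    by move=> p /mapP[j _ ->] /=.
  (* Through [b], the tuples [a] and [a'] are matched within [x], where stage [T] yields all stages;
     the way back to [b] costs another [d / 2]. *)
  have aa' := TP _ _ _ (bf_close_trans Hab (bf_close_sym (a'b T))).
  rewrite (_ : e + d = e + d / 2 + d / 2); last by lra.
  exact: bf_close_trans (aa' (stage_succ T)) (a'b (stage_succ T)).
move=> q [H0 HS]; apply: back_and_forth H0 _ => a b e.
exact: (HS (a, b, e)).
Qed.

End Borel.
End Scott.

(** * Hausdorff distances and dense sequences *)

Section Hausdorff.
Context {R : realType} {C : pseudoMetricType R}.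
Implicit Types (S T : set C) (e : R).

Lemma hausdorff_distC S T : hausdorff_dist S T = hausdorff_dist T S.
Proof. by rewrite /hausdorff_dist maxC. Qed.

Lemma hausdorff_dist_lt S T e x : (hausdorff_dist S T < e%:E)%E -> S x ->
  exists2 y, T y & ball x e y.
Proof.
rewrite /hausdorff_dist gt_max => /andP[lt_e _] Sx.
have : (edist_inf T x < e%:E)%E.
  by apply: le_lt_trans lt_e; apply: ereal_sup_ubound; exists x.
move=> /ereal_inf_lt[_ [y Ty <-]] /edist_lt_ball xy.
by exists y.
Qed.

Lemma hausdorff_dist_le S T e : 0 < e ->
    (forall x, S x -> exists2 y, T y & ball x e y) ->
    (forall y, T y -> exists2 x, S x & ball x e y) ->
  (hausdorff_dist S T <= e%:E)%E.
Proof.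
move=> e0 HS HT; rewrite /hausdorff_dist ge_max; apply/andP; split.
- apply: ge_ereal_sup => _ [x /HS[y Ty xy] <-].
  apply: le_trans (edist_fin (xy := (x, y)) e0 xy).
  by apply: ereal_inf_lbound; exists y.
- apply: ge_ereal_sup => _ [y /HT[x Sx /ball_sym yx] <-].
  apply: le_trans (edist_fin (xy := (y, x)) e0 yx).
  by apply: ereal_inf_lbound; exists x.
Qed.

(** The point excludes two empty sets, for which both suprema are [-oo]. *)
Lemma hausdorff_dist_ge0 S T x : S x -> (0 <= hausdorff_dist S T)%E.
Proof.
move=> Sx; rewrite /hausdorff_dist le_max; apply/orP; left.
apply: le_trans (edist_inf_ge0 T x) _.
by apply: ereal_sup_ubound; exists x.
Qed.

End Hausdorff.

Lemma ereal_inf_eq0P {R : realType} (E : set (\bar R)) :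
  (forall r, E r -> (0 <= r)%E) ->
  (forall e : R, 0 < e -> exists2 r, E r & (r <= e%:E)%E) ->
  ereal_inf E = 0%E.
Proof.
move=> E0 Ee; apply/eqP; rewrite eq_le; apply/andP; split; last first.
  exact: le_ereal_inf_tmp.
apply/lee_addgt0Pr => e e0; rewrite add0e.
have [r Er re] := Ee _ e0.
by apply: le_trans re; exact: ereal_inf_lbound.
Qed.

Lemma tail_dense_range {T : topologicalType} (a : nat -> T) :
  tail_dense a -> dense (range a).
Proof.
move=> /(_ 0%N) da O O0 oO; have [x [Ox [i _ ix]]] := da O O0 oO.
by exists x; split=> //; exists i.
Qed.

Lemma separable_dense_sequence {T : topologicalType} (x : T) :
  separable T -> exists a : nat -> T, dense (range a).
Proof.
move=> [D cD dD].
have [y [_ Dy]] : [set: T] `&` D !=set0 by apply: dD; [exists x|exact: openT].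
have [D0|/surjfunPex[a aD]] := pfcard_geP cD; first by move: Dy; rewrite D0.
by exists a; rewrite -aD.
Qed.

Lemma dense_ball {R : realType} {T : pseudoMetricType R} (I : Type) (a : I -> T) (x : T) (e : R) :
  dense (range a) -> 0 < e -> exists i, ball x e (a i).
Proof.
(* A ball of a pseudometric type need not be open, so density is applied to its interior. *)
move=> da e0; have [y [By [i _ iy]]] : (ball x e)^° `&` range a !=set0.
  apply: da; last exact: open_interior.
  by exists x; exact: nbhsx_ballx.
by exists i; rewrite iy; exact: interior_subset By.
Qed.

Lemma ball_mdistE {R : numDomainType} {T : metricType R} (x y : T) (e : R) :
  ball x e y = (mdist x y < e) :> Prop.
Proof. by rewrite ballEmdist. Qed.

(** * The truncated supremum metric on real sequences *)

Section SupSpace.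
Variable R : realType.

(* Truncating at 1 is harmless for spaces of diameter at most 1, and makes the
   supremum metric finite on all sequences. *)
Definition sup_space : Type := nat -> R.

HB.instance Definition _ := Choice.copy sup_space (nat -> R).

Implicit Types (f g h : sup_space).

Let gap f g := range (fun n => Num.min `|f n - g n| 1).

Definition sup_dist f g : R := sup (gap f g).

Let gap_has_sup f g : has_sup (gap f g).
Proof.
split; first by exists (Num.min `|f 0%N - g 0%N| 1), 0%N.
by exists 1 => _ [n _ <-]; rewrite ge_min lexx orbT.
Qed.

Lemma sup_dist_ge f g n : Num.min `|f n - g n| 1 <= sup_dist f g.
Proof. by apply: (ub_le_sup (gap_has_sup f g).2); exists n. Qed.

Lemma sup_dist_le f g r :
  (forall n, Num.min `|f n - g n| 1 <= r) -> sup_dist f g <= r.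
Proof.
move=> H; apply: ge_sup; first by case: (gap_has_sup f g).
by move=> _ [n _ <-].
Qed.

Let sup_distxx f : sup_dist f f = 0.
Proof.
apply/eqP; rewrite eq_le; apply/andP; split.
  by apply: sup_dist_le => n; rewrite subrr normr0 ge_min lexx.
rewrite (le_trans _ (sup_dist_ge f f 0%N))//; rewrite subrr normr0 le_min lexx ler01.
Qed.

Let sup_dist_positivity f g : sup_dist f g = 0 -> f = g.
Proof.
move=> fg0; apply/funext => n; have := sup_dist_ge f g n.
rewrite fg0 ge_min (leNgt 1) ltr01 orbF normr_le0 subr_eq0.
by move/eqP.
Qed.

Let sup_dist_sym f g : sup_dist f g = sup_dist g f.
Proof. by rewrite /sup_dist /gap; under eq_fun do rewrite distrC. Qed.

Let sup_dist_triangle g f h : sup_dist f h <= sup_dist f g + sup_dist g h.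
Proof.
apply: sup_dist_le => n; rewrite (le_trans _ (lerD (sup_dist_ge f g n) (sup_dist_ge g h n)))//.
have := ler_distD (g n) (f n) (h n).
rewrite !minEle; case: ifP; case: ifP; case: ifP; do ?[lra].
all: have := normr_ge0 (f n - g n); have := normr_ge0 (g n - h n); have := normr_ge0 (f n - h n).
all: do ?[move=> *; lra].
Qed.

HB.instance Definition _ := isMetric.Build R sup_space
  sup_distxx sup_dist_positivity sup_dist_sym sup_dist_triangle.

Lemma sup_space_mdistE f g : mdist f g = sup_dist f g.
Proof. by []. Qed.

End SupSpace.

Lemma ptws_eval_continuous {I : Type} {T : topologicalType} (i : I) :
  continuous (fun p : {ptws I -> T} => p i).
Proof.
move=> p; have /cvg_sup/(_ i) ip : nbhs p --> p by exact: cvg_id.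
move=> U Upi; apply: (ip (fun q => U (q i))).
exact: (@initial_continuous {ptws I -> T} T (fun q => q i) p U Upi).
Qed.

Lemma borel_coordinate_lt {R : realType} {I : Type} (D : set {ptws I -> R}) (i : I) (r : R) :
  borel [set p : D | set_val p i < r].
Proof.
apply: sub_sigma_algebra; exists ((fun p : {ptws I -> R} => p i) @^-1` [set u | u < r]) => //.
apply: open_comp; last exact: open_lt.
by move=> p _; exact: ptws_eval_continuous.
Qed.

(** * Gromov-Hausdorff distance *)

Section MetricSpaces.
Context {R : realType}.

(** A test names two positions of the tuple; the default 0 makes positions beyond the end harmless
    for tuples of equal length. *)
Definition metric_test (p : nat * nat -> R) (t : nat * nat) (s : seq nat) : R :=
  if (t.1 < size s)%N && (t.2 < size s)%N then p (nth 0%N s t.1, nth 0%N s t.2) else 0.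

Definition metric_weight (t : nat * nat) : R := 1.

Lemma metric_weight_ge0 t : 0 <= metric_weight t.
Proof. exact: ler01. Qed.

(** The Frechet embedding given by the sequence [x]. *)
Definition distances_to {A : metricType R} (x : nat -> A) (z : A) : sup_space R :=
  fun n => mdist z (x n).

(** The triangle inequality bounds every coordinate, and the coordinate of some [x n] close to [z']
    almost attains the distance. *)
Lemma distances_to_isometric (A : metricType R) (x : nat -> A) :
  diameter_le1 A -> dense (range x) -> isometric (distances_to x).
Proof.
move=> A1 dx z z'; rewrite sup_space_mdistE; apply/eqP; rewrite eq_le; apply/andP; split.
  apply: sup_dist_le => n; rewrite ge_min; apply/orP; left.
  rewrite /distances_to ler_norml lerBlDr lerNl opprB lerBlDr metric_triangle andbT.
  by rewrite (metric_sym z z') metric_triangle.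
apply/ler_addgt0Pr => e e0.
have e20 : 0 < e / 2 by rewrite divr_gt0.
have [n] := dense_ball z' dx e20; rewrite ball_mdistE => zn.
have := sup_dist_ge (distances_to x z) (distances_to x z') n.
rewrite /distances_to ge_min => /orP[H|H]; last first.
  by have := A1 z z'; lra.
have := ler_norm (mdist z (x n) - mdist z' (x n)).
have := metric_triangle z (x n) z'; rewrite (metric_sym (x n)).
by move: zn H; lra.
Qed.

Lemma distances_to_near (A B : metricType R) (x : nat -> A) (y : nat -> B) (e : R) (z : A) :
    dense (range x) -> 0 < e ->
    (forall m n, `|mdist (x m) (x n) - mdist (y m) (y n)| <= e) ->
  exists n, ball (distances_to x z) (3 * e) (distances_to y (y n)).
Proof.
move=> dx e0 H; have [n] := dense_ball z dx e0; rewrite ball_mdistE => zn.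
exists n; rewrite ball_mdistE sup_space_mdistE.
(* One [e] pays for replacing [z] by [x n], one for passing from [x] to [y]; the third makes the
   inequality strict. *)
apply: (@le_lt_trans _ _ (2 * e)); last by lra.
apply: sup_dist_le => m; rewrite ge_min; apply/orP; left.
have := H n m; rewrite /distances_to !ler_norml.
have := metric_triangle z (x n) (x m); have := metric_triangle (x n) z (x m).
by rewrite (metric_sym (x n) z) => *; apply/andP; split; lra.
Qed.

(** Reindexed along matched enumerations, the two dense sequences give Frechet embeddings into one
    space with comparable coordinates. *)
Lemma gromov_hausdorff_dist_eq0 (A B : metricType R) (a : nat -> A) (b : nat -> B) :
    diameter_le1 A -> diameter_le1 B -> dense (range a) -> dense (range b) ->
    (forall e : rat, 0 < e -> exists f g : nat -> nat,
      [/\ forall i, exists n, f n = i, forall j, exists n, g n = j &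
        forall n, bf_close metric_weight stage0 (metric_test (metric_code a))
          (metric_test (metric_code b)) (mkseq f n) (mkseq g n) e]) ->
  gromov_hausdorff_dist A B = 0%E.
Proof.
move=> A1 B1 da db H; apply: ereal_inf_eq0P.
  move=> _ [C [f1 [f2 [_ _ ->]]]].
  by apply: (@hausdorff_dist_ge0 _ _ _ _ (f1 (a 0%N))); exists (a 0%N).
move=> e e0; have /ratr_between[d /andP[d0 de]] : 0 < e / 3 by rewrite divr_gt0.
have [|f [g [fs gs fg]]] := H d; first by rewrite -(ltr_rat R) rmorph0.
have range_comp (T : Type) (c : nat -> T) h : (forall i, exists n, h n = i) ->
    range (c \o h) = range c.
  move=> hs; apply/seteqP; split=> [_ [n _ <-]|_ [i _ <-]]; first by exists (h n).
  by have [n hn] := hs i; exists n => //=; rewrite hn.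
have dx : dense (range (a \o f)) by rewrite range_comp.
have dy : dense (range (b \o g)) by rewrite range_comp.
have xy m n : `|mdist (a (f m)) (a (f n)) - mdist (b (g m)) (b (g n))| <= ratr d.
  (* This is the least length at which both positions lie inside the tuples. *)
  have := fg (maxn m n).+1 (m, n); rewrite /metric_test /metric_weight mulr1 !size_mkseq /=.
  by rewrite !ltnS leq_maxl leq_maxr /= !nth_mkseq ?ltnS ?leq_maxl ?leq_maxr.
exists (hausdorff_dist (range (distances_to (a \o f))) (range (distances_to (b \o g)))).
  exists (sup_space R), (distances_to (a \o f)), (distances_to (b \o g)).
  by split=> //; exact: distances_to_isometric.
apply: le_trans (_ : ((3 * ratr d)%:E <= _)%E); last by rewrite lee_fin; lra.
apply: hausdorff_dist_le; first by lra.
- move=> _ [z _ <-]; have [n ?] := distances_to_near z dx d0 xy.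
  by exists (distances_to (b \o g) (b (g n))) => //; exists (b (g n)).
- move=> _ [z _ <-].
  have [|n /ball_sym ?] := @distances_to_near _ _ _ (a \o f) _ z dy d0.
    by move=> m n; rewrite distrC; exact: xy.
  by exists (distances_to (a \o f) (a (f n))) => //; exists (a (f n)).
Qed.

Lemma gromov_hausdorff_dist_relation (A B : metricType R) (a : nat -> A) (b : nat -> B) :
    dense (range a) -> dense (range b) -> gromov_hausdorff_dist A B = 0%E ->
  forall e : rat, 0 < e -> exists E : nat -> nat -> Prop,
    [/\ forall i, exists j, E i j, forall j, exists i, E i j &
        forall s : seq (nat * nat), {in s, forall p, E p.1 p.2} ->
          bf_close metric_weight stage0 (metric_test (metric_code a))
            (metric_test (metric_code b)) (unzip1 s) (unzip2 s) e].
Proof.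
(* Related points have images within [2 * r], one [r] from the Hausdorff distance and one from
   density, so distances between two related pairs differ by at most [4 * r]. *)
move=> da db AB0 e e0; pose r : R := ratr e / 4.
have r0 : 0 < r by rewrite divr_gt0 // -(rmorph0 (@ratr R)) ltr_rat.
have : (gromov_hausdorff_dist A B < r%:E)%E by rewrite AB0 lte_fin.
move=> /ereal_inf_lt[_ [C [f1 [f2 [i1 i2 ->]]]] fr].
exists (fun i j => mdist (f1 (a i)) (f2 (b j)) < 2 * r); split.
- move=> i; have [|_ [y _ <-]] := hausdorff_dist_lt (x := f1 (a i)) fr; first by exists (a i).
  rewrite ball_mdistE => ay; have [j] := dense_ball y db r0; rewrite ball_mdistE -i2 => yj.
  by exists j; have := metric_triangle (f1 (a i)) (f2 y) (f2 (b j)); lra.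
- rewrite hausdorff_distC in fr.
  move=> j; have [|_ [x _ <-]] := hausdorff_dist_lt (x := f2 (b j)) fr; first by exists (b j).
  rewrite ball_mdistE metric_sym => ax; have [i] := dense_ball x da r0.
  rewrite ball_mdistE -i1 metric_sym => xi.
  by exists i; have := metric_triangle (f1 (a i)) (f1 x) (f2 (b j)); lra.
move=> s sE [k l]; rewrite /metric_test /metric_weight mulr1 !size_map /=.
case: ifP => [/andP[ks ls]|_]; last by rewrite subrr normr0 ler0q ltW.
have := sE _ (mem_nth (0, 0)%N ks); have := sE _ (mem_nth (0, 0)%N ls).
rewrite /unzip1 /unzip2 !(nth_map (0, 0)%N)//.
move: (nth _ s k) (nth _ s l) => [i j] [i' j'] /=; rewrite /metric_code /=.
rewrite -i1 -i2.
have := metric_triangle (f1 (a i)) (f2 (b j)) (f1 (a i')).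
have := metric_triangle (f2 (b j)) (f2 (b j')) (f1 (a i')).
have := metric_triangle (f2 (b j)) (f1 (a i)) (f2 (b j')).
have := metric_triangle (f1 (a i)) (f1 (a i')) (f2 (b j')).
rewrite (metric_sym (f2 (b j)) (f1 (a i))) (metric_sym (f2 (b j')) (f1 (a i'))).
have -> : ratr e = 4 * r by rewrite /r; lra.
by move=> *; rewrite ler_norml; apply/andP; split; lra.
Qed.

Theorem borel_gromov_hausdorff_eq0 (A : metricType R) :
    polish_metric A -> diameter_le1 A ->
  borel [set p : metric_codes R | exists2 B : metricType R,
    codes_metric (set_val p) B & gromov_hausdorff_dist A B = 0%E].
Proof.
move=> [sA _] A1.
have sB : sigma_algebra [set: metric_codes R] borel := smallest_sigma_algebra _ _.
(* An empty [A] is at infinite distance from every coded space, since a coded space contains a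
   sequence. *)
have [[x _]|A0] := pselect (exists x : A, True); last first.
  rewrite (_ : [set p | _] = [set _ | False]); first exact: (sigma_algebra_cst sB).
  apply/seteqP; split=> // p [B [_ _ [b _ _]] AB0].
  have : (gromov_hausdorff_dist A B < 1%:E)%E by rewrite AB0 lte_fin.
  move=> /ereal_inf_lt[_ [C [f1 [f2 [_ _ ->]]]]].
  rewrite hausdorff_distC => /(hausdorff_dist_lt (x := f2 (b 0%N))).
  by move=> [|u [z _ _] _]; [exists (b 0%N)|case: A0; exists z].
have [a da] := separable_dense_sequence x sA.
have [|Y [SY Yl Yr]] := scott_set metric_weight_ge0 sB (metric_test (metric_code a))
    (F := fun p : metric_codes R => metric_test (set_val p)).
  move=> t s r; rewrite /metric_test; case: (_ && _); first exact: borel_coordinate_lt.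
  exact: (sigma_algebra_cst sB).
rewrite (_ : [set p | _] = Y)//; apply/seteqP; split=> p.
  move=> [B [_ B1 [b /tail_dense_range db pb]] AB0]; apply: Yl => e e0.
  by rewrite pb; exact: gromov_hausdorff_dist_relation.
(* Membership in [Y] depends on the code alone, so any space coded by [p] serves as witness. *)
move=> /Yr Yp; have /set_mem[B pB] : set_val p \in metric_codes R by exact: valP.
exists B => //; case: pB => [_ B1 [b /tail_dense_range db pb]].
by apply: gromov_hausdorff_dist_eq0 da db _ => // e /Yp; rewrite pb.
Qed.

End MetricSpaces.

(** * Amalgams of Banach spaces *)

Lemma ball_normrE {K : numDomainType} {V : pseudoMetricNormedZmodType K} (u v : V) (r : K) :
  ball u r v = (`|u - v| < r) :> Prop.
Proof. by rewrite -ball_normE. Qed.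

Section Combinations.
Context {R : realType} {V : normedModType R}.
Implicit Types (l : seq (R * nat)) (x : nat -> V).

Definition lincomb l x : V := \sum_(t <- l) t.1 *: x t.2.

Definition weight l : R := \sum_(t <- l) `|t.1|.

Lemma weight_ge0 l : 0 <= weight l.
Proof. by apply: sumr_ge0. Qed.

Lemma lincomb_cat l1 l2 x : lincomb (l1 ++ l2) x = lincomb l1 x + lincomb l2 x.
Proof. exact: big_cat. Qed.

Lemma weight_cat l1 l2 : weight (l1 ++ l2) = weight l1 + weight l2.
Proof. exact: big_cat. Qed.

Definition scale_coefs (r : R) l := [seq (r * t.1, t.2) | t <- l].

Lemma lincomb_scale r l x : lincomb (scale_coefs r l) x = r *: lincomb l x.
Proof.
rewrite /lincomb big_map scaler_sumr; apply: eq_bigr => t _ /=.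
by rewrite scalerA.
Qed.

Lemma weight_scale r l : weight (scale_coefs r l) = `|r| * weight l.
Proof.
rewrite /weight big_map mulr_sumr; apply: eq_bigr => t _ /=.
by rewrite normrM.
Qed.

Lemma norm_lincomb l x : (forall n, `|x n| <= 1) -> `|lincomb l x| <= weight l.
Proof.
move=> x1; rewrite (le_trans (ler_norm_sum _ _ _))//; apply: ler_sum => t _.
by rewrite normrZ ler_piMr.
Qed.

End Combinations.

(** The data for gluing [coupling_l n] to [coupling_r n] within [coupling_eps]; the last field keeps
    the norms of [A] and [B] unchanged in the glued space. *)
Record coupling (R : realType) (A B : normedModType R) := Coupling {
  coupling_l : nat -> A;
  coupling_r : nat -> B;
  coupling_eps : R;
  coupling_eps_gt0 : 0 < coupling_eps;
  coupling_l_le1 : forall n, `|coupling_l n| <= 1;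
  coupling_r_le1 : forall n, `|coupling_r n| <= 1;
  coupling_isometry : forall l : seq (R * nat),
    `| `|lincomb l coupling_l| - `|lincomb l coupling_r| | <= coupling_eps * weight l }.

Section AmalgamatedSum.
Context {R : realType} {A B : completeNormedModType R} (c : coupling A B).

Local Notation x := (coupling_l c).
Local Notation y := (coupling_r c).
Local Notation eps := (coupling_eps c).

Let eps0 : 0 < eps := coupling_eps_gt0 c.

(* The norm of the amalgam is equivalent to that of the product because
   [coupling_eps > 0], so no quotient or completion has to be taken. *)
Definition amalgam (K : coupling A B) : Type := (A * B)%type.

HB.instance Definition _ := GRing.Lmodule.copy (amalgam c) (A * B)%type.

Implicit Types (z : amalgam c) (l : seq (R * nat)).

(** The list [l] trades a combination of the [x n] in [A] for the same combination of the [y n] in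
    [B], at price [eps] per unit of coefficient. The infimum of the costs is the largest seminorm
    that is at most the given norm on each factor and at most [eps] on each [(x n, - y n)]. *)
Definition amalgam_cost z l : R :=
  `|z.1 - lincomb l x| + `|z.2 + lincomb l y| + eps * weight l.

Definition amalgam_norm z : R := inf (range (amalgam_cost z)).

Let cost_ge0 z l : 0 <= amalgam_cost z l.
Proof. by rewrite !addr_ge0// mulr_ge0 ?weight_ge0// ltW. Qed.

Lemma amalgam_norm_le z l : amalgam_norm z <= amalgam_cost z l.
Proof. by apply: ge_inf; [exists 0 => _ [k _ <-]|exists l]. Qed.

Lemma amalgam_norm_ge z r : (forall l, r <= amalgam_cost z l) -> r <= amalgam_norm z.
Proof.
move=> H; apply: lb_le_inf; first by exists (amalgam_cost z [::]), [::].
by move=> _ [l _ <-].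
Qed.

Let norm_leD z z' : amalgam_norm (z + z') <= amalgam_norm z + amalgam_norm z'.
Proof.
rewrite -lerBlDr; apply: amalgam_norm_ge => l; rewrite lerBlDr -lerBlDl.
apply: amalgam_norm_ge => l'; rewrite lerBlDl.
apply: le_trans (amalgam_norm_le _ (l ++ l')) _.
rewrite /amalgam_cost !lincomb_cat weight_cat /=.
have := ler_normD (z.1 - lincomb l x) (z'.1 - lincomb l' x).
have := ler_normD (z.2 + lincomb l y) (z'.2 + lincomb l' y).
by rewrite opprD !(addrACA z.1 z'.1) !(addrACA z.2 z'.2); lra.
Qed.

Let normZ_le r z : amalgam_norm (r *: z) <= `|r| * amalgam_norm z.
Proof.
have [->|r0] := eqVneq r 0.
  rewrite normr0 mul0r; apply: le_trans (amalgam_norm_le _ [::]) _.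
  by rewrite /amalgam_cost /lincomb /weight !big_nil /= !scale0r subr0 addr0 !normr0 mulr0 !addr0.
rewrite -ler_pdivrMl ?normr_gt0//; apply: amalgam_norm_ge => l.
rewrite ler_pdivrMl ?normr_gt0//; apply: le_trans (amalgam_norm_le _ (scale_coefs r l)) _.
rewrite /amalgam_cost !lincomb_scale weight_scale /= -scalerBr -scalerDr !normrZ.
by rewrite !mulrDr mulrCA.
Qed.

Let normZ r z : amalgam_norm (r *: z) = `|r| * amalgam_norm z.
Proof.
apply/eqP; rewrite eq_le normZ_le /=.
have [->|r0] := eqVneq r 0.
  rewrite normr0 mul0r; exact: amalgam_norm_ge.
rewrite -ler_pdivlMl ?normr_gt0// -normfV -[in leLHS](scalerK r0 z).
exact: normZ_le.
Qed.

(** Adding the combination back costs at most its weight, which is [eps^-1] times the last term of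
    the cost. Together with [norm_snd] this gives definiteness and completeness. *)
Let norm_fst z : `|z.1| <= (1 + eps^-1) * amalgam_norm z.
Proof.
rewrite -ler_pdivrMl; last by rewrite addr_gt0// invr_gt0.
apply: amalgam_norm_ge => l; rewrite ler_pdivrMl; last by rewrite addr_gt0// invr_gt0.
rewrite mulrDl mul1r /amalgam_cost.
apply: (@le_trans _ _ (`|z.1 - lincomb l x| + weight l)).
  rewrite -[X in `|X| <= _](subrK (lincomb l x)).
  by rewrite (le_trans (ler_normD _ _))// lerD2l norm_lincomb//; exact: coupling_l_le1.
rewrite -!addrA lerD2l !addrA; apply: ler_wpDl.
  by rewrite addr_ge0// mulr_ge0 ?weight_ge0// ltW.
by rewrite mulrDr mulKf ?gt_eqF// lerDr mulr_ge0 ?addr_ge0// invr_ge0 ltW.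
Qed.

Let norm_snd z : `|z.2| <= (1 + eps^-1) * amalgam_norm z.
Proof.
rewrite -ler_pdivrMl; last by rewrite addr_gt0// invr_gt0.
apply: amalgam_norm_ge => l; rewrite ler_pdivrMl; last by rewrite addr_gt0// invr_gt0.
rewrite mulrDl mul1r /amalgam_cost.
apply: (@le_trans _ _ (`|z.2 + lincomb l y| + weight l)).
  rewrite -[X in `|X| <= _](addrK (lincomb l y)).
  by rewrite (le_trans (ler_normB _ _))// lerD2l norm_lincomb//; exact: coupling_r_le1.
rewrite (addrC `|z.1 - _|) -!addrA lerD2l !addrA; apply: ler_wpDl.
  by rewrite addr_ge0// mulr_ge0 ?weight_ge0// ltW.
by rewrite mulrDr mulKf ?gt_eqF// lerDr mulr_ge0 ?addr_ge0// invr_ge0 ltW.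
Qed.

Let norm_eq0 z : amalgam_norm z = 0 -> z = 0.
Proof.
move=> z0; have := norm_fst z; have := norm_snd z; rewrite z0 mulr0 !normr_le0.
by case: z {z0} => [z1 z2] /= /eqP-> /eqP->.
Qed.

HB.instance Definition _ :=
  Lmodule_isNormed.Build R (amalgam c) norm_leD normZ norm_eq0.

Lemma amalgam_norm_max z : `|z| <= `|z.1| + `|z.2|.
Proof.
apply: le_trans (amalgam_norm_le _ [::]) _.
by rewrite /amalgam_cost /lincomb /weight !big_nil subr0 mulr0 !addr0.
Qed.

Let amalgam_complete (F : set_system (amalgam c)) :
  ProperFilter F -> cauchy F -> cvg F.
Proof.
move=> FF Fc; pose k := 1 + eps^-1.
have k0 : 0 < k by rewrite addr_gt0// invr_gt0.
have c1 : cauchy (fst @ F : set_system A).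
  apply/cauchyP => e e0; have ek0 : 0 < e / k by rewrite divr_gt0.
  have [z Fz] := (cauchyP F).1 Fc _ ek0; exists z.1.
  apply: (@filterS (amalgam c) F _ (ball z (e / k))) Fz => z' zz'.
  have {zz'} : `|z - z'| < e / k by rewrite -ball_normrE.
  rewrite ltr_pdivlMr// mulrC => lt_e.
  by rewrite /= ball_normrE; apply: le_lt_trans lt_e; exact: (norm_fst (z - z')).
have c2 : cauchy (snd @ F : set_system B).
  apply/cauchyP => e e0; have ek0 : 0 < e / k by rewrite divr_gt0.
  have [z Fz] := (cauchyP F).1 Fc _ ek0; exists z.2.
  apply: (@filterS (amalgam c) F _ (ball z (e / k))) Fz => z' zz'.
  have {zz'} : `|z - z'| < e / k by rewrite -ball_normrE.
  rewrite ltr_pdivlMr// mulrC => lt_e.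
  by rewrite /= ball_normrE; apply: le_lt_trans lt_e; exact: (norm_snd (z - z')).
have Fa : cvg (fst @ F : set_system A) by exact: cauchy_cvg c1.
have Fb : cvg (snd @ F : set_system B) by exact: cauchy_cvg c2.
pose z0 : amalgam c := (lim (fst @ F : set_system A), lim (snd @ F : set_system B)).
apply: (cvgP z0); apply/fcvgrPdist_lt => e e0.
have e20 : 0 < e / 2 by rewrite divr_gt0.
have /cvgrPdist_lt/(_ _ e20) zb := Fb; have /cvgrPdist_lt/(_ _ e20) za := Fa.
apply: filterS2 zb za => z zb za; apply: le_lt_trans (amalgam_norm_max _) _ => /=.
by rewrite [ltRHS]splitr ltrD.
Qed.

HB.instance Definition _ := Uniform_isComplete.Build (amalgam c) amalgam_complete.

Definition amalgam_inl (a : A) : amalgam c := (a, 0).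

Definition amalgam_inr (b : B) : amalgam c := (0, b).

Let inl_linear : linear amalgam_inl.
Proof.
move=> r a a'; rewrite /amalgam_inl; congr pair.
by rewrite /= scaler0 addr0.
Qed.

Let inr_linear : linear amalgam_inr.
Proof.
move=> r b b'; rewrite /amalgam_inr; congr pair.
by rewrite /= scaler0 addr0.
Qed.

HB.instance Definition _ :=
  GRing.isLinear.Build R A (amalgam c) *:%R amalgam_inl inl_linear.

HB.instance Definition _ :=
  GRing.isLinear.Build R B (amalgam c) *:%R amalgam_inr inr_linear.

(** For the lower bound, exchanging the norm of [lincomb l x] for that of [lincomb l y] loses at
    most [eps * weight l], exactly the last term of the cost. *)
Lemma norm_amalgam_inl a : `|amalgam_inl a| = `|a|.
Proof.
apply/eqP; rewrite eq_le; apply/andP; split.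
  by have := amalgam_norm_max (amalgam_inl a); rewrite /= normr0 addr0.
apply: amalgam_norm_ge => l; rewrite /amalgam_cost /= add0r.
have := ler_normD (a - lincomb l x) (lincomb l x); rewrite subrK.
by have := coupling_isometry c l; rewrite ler_norml => /andP[_]; lra.
Qed.

Lemma norm_amalgam_inr b : `|amalgam_inr b| = `|b|.
Proof.
apply/eqP; rewrite eq_le; apply/andP; split.
  by have := amalgam_norm_max (amalgam_inr b); rewrite /= normr0 add0r.
apply: amalgam_norm_ge => l; rewrite /amalgam_cost /= sub0r normrN.
have := ler_normB (b + lincomb l y) (lincomb l y); rewrite addrK.
by have := coupling_isometry c l; rewrite ler_norml => /andP[+ _]; lra.
Qed.

Lemma amalgam_coupled n : `|amalgam_inl (x n) - amalgam_inr (y n)| <= eps.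
Proof.
(* This combination cancels both entries and leaves only the price [eps]. *)
apply: le_trans (amalgam_norm_le _ [:: (1, n)]) _.
rewrite /amalgam_cost /lincomb /weight !big_seq1 /= !scale1r normr1 mulr1 subr0 sub0r.
by rewrite subrr addNr !normr0 !add0r.
Qed.

End AmalgamatedSum.

(** Both sequences are [d]-nets of the unit balls: a point moves by less than [d] to its net and by
    at most [coupling_eps c] across the amalgam. *)
Lemma kadets_dist_le {R : realType} (A B : completeNormedModType R) (c : coupling A B) (d : R) :
    0 < d ->
    (forall z, `|z| <= 1 -> exists n, `|z - coupling_l c n| < d) ->
    (forall z, `|z| <= 1 -> exists n, `|z - coupling_r c n| < d) ->
  exists (C : completeNormedModType R) (f1 : {linear A -> C}) (f2 : {linear B -> C}),
    [/\ forall x, `|f1 x| = `|x|, forall y, `|f2 y| = `|y| &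
        (hausdorff_dist (f1 @` @unit_ball R A) (f2 @` @unit_ball R B) <=
          (d + coupling_eps c)%:E)%E].
Proof.
move=> d0 Hl Hr; exists (amalgam c), (@amalgam_inl _ _ _ c), (@amalgam_inr _ _ _ c).
split; [exact: norm_amalgam_inl|exact: norm_amalgam_inr|].
apply: hausdorff_dist_le; first by rewrite addr_gt0// coupling_eps_gt0.
- move=> _ [z z1 <-]; have [n zn] := Hl z z1.
  exists (amalgam_inr c (coupling_r c n)).
    by exists (coupling_r c n) => //; exact: coupling_r_le1.
  rewrite ball_normrE -(subrKA (amalgam_inl c (coupling_l c n))).
  rewrite (le_lt_trans (ler_normD _ _))//; apply: ltr_leD; last exact: amalgam_coupled.
  by rewrite -raddfB norm_amalgam_inl.
- move=> _ [z z1 <-]; have [n zn] := Hr z z1.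
  exists (amalgam_inl c (coupling_l c n)).
    by exists (coupling_l c n) => //; exact: coupling_l_le1.
  rewrite ball_normrE distrC -(subrKA (amalgam_inr c (coupling_r c n))).
  rewrite (le_lt_trans (ler_normD _ _))//; apply: ltr_leD.
    by rewrite -raddfB norm_amalgam_inr.
  by rewrite distrC; exact: amalgam_coupled.
Qed.

(** * Norms of linear combinations from codes *)

Section UnitBallSequence.
Context {R : realType} {V : normedModType R}.
Implicit Types (a : nat -> V).

(* Every index is a legal move in the unit ball: the vectors outside the open
   ball are replaced by 0. *)
Definition clip a (i : nat) : V := if `|a i| < 1 then a i else 0.

Lemma norm_clip_le1 a i : `|clip a i| <= 1.
Proof. by rewrite /clip; case: ifP => [/ltW//|_]; rewrite normr0 ler01. Qed.

Lemma clip_dense a (z : V) (d : R) :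
  dense (range a) -> `|z| <= 1 -> 0 < d -> exists i, `|z - clip a i| < d.
Proof.
(* Shrinking [z] by the factor [1 - t] leaves room [t] in the unit ball, so an approximation within
   [t] is not clipped; the two moves together cost less than [d]. *)
move=> da z1 d0; pose t := Num.min d 1 / 2.
have m0 : 0 < Num.min d 1 by rewrite lt_min d0 ltr01.
have t0 : 0 < t by rewrite divr_gt0.
have [td t1] : t <= d / 2 /\ t <= 1 / 2.
  by split; rewrite ler_pM2r// ge_min lexx ?orbT.
have [i] := dense_ball ((1 - t) *: z) da t0; rewrite ball_normrE => zi.
have tz : `|(1 - t) *: z| <= 1 - t by rewrite normrZ ger0_norm; [rewrite ler_piMr//|]; lra.
exists i; rewrite /clip ifT.
  have := ler_normB z ((1 - t) *: z); have := ler_distD ((1 - t) *: z) z (a i).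
  have -> : z - (1 - t) *: z = t *: z by rewrite scalerBl scale1r opprB addrCA subrr addr0.
  have : `|t *: z| <= t by rewrite normrZ gtr0_norm// ler_piMr// ltW.
  by lra.
have := ler_normB ((1 - t) *: z) ((1 - t) *: z - a i).
by rewrite opprB addrC subrK; lra.
Qed.

Definition ratcomb (l : seq (rat * nat)) (x : nat -> V) : V :=
  \sum_(p <- l) ratr p.1 *: x p.2.

Lemma ratcomb_cons p l (x : nat -> V) :
  ratcomb (p :: l) x = ratr p.1 *: x p.2 + ratcomb l x.
Proof. by rewrite /ratcomb big_cons. Qed.

End UnitBallSequence.

Section Tests.
Context {R : realType}.

Definition select (t : seq (rat * nat)) (s : seq nat) : seq (rat * nat) :=
  [seq (p.1, nth 0%N s p.2) | p <- t & (p.2 < size s)%N].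

Definition banach_test {V : normedModType R} (a : nat -> V) t s : R :=
  `|ratcomb (select t s) (clip a)|.

Definition banach_weight (t : seq (rat * nat)) : R := \sum_(p <- t) `|ratr p.1|.

Lemma banach_weight_ge0 t : 0 <= banach_weight t.
Proof. by apply: sumr_ge0. Qed.

(* For [d <= 1] and a code [q] of [b], the condition [code_near q l j d] means
   that [ratcomb l (clip b)] is at distance less than [d] from [b j]. *)
Fixpoint code_near (q : banach_index -> R) (l : seq (rat * nat)) (j : nat) (d : rat) : Prop :=
  match l with
  | [::] => q (bzero j) < ratr d
  | (c, i) :: l' =>
      (q (bnorm 0 i) < 1 -> exists k m (e : rat),
        [/\ q (bscale c i k) < ratr e, code_near q l' m e & q (badd k m j) < ratr (d - e - e)]) /\
      (~ q (bnorm 0 i) < 1 -> code_near q l' j d)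
  end.

(** The bounds on [d] and [e] make both truncations in the code invisible; a vector within [d] of
    some [b j] of norm below [e] has norm below [d + e]. *)
Definition code_norm_lt (q : banach_index -> R) (l : seq (rat * nat)) (r : R) : Prop :=
  exists j n (d e : rat), [/\ d <= 1, ratr e <= n.+1%:R :> R, ratr (d + e) <= r,
    code_near q l j d & q (bnorm n j) < ratr e].

(** The norm is recovered from its strict upper bounds, so it becomes a function of the code alone
    and no coded space has to be chosen. *)
Definition code_test (q : banach_index -> R) t s : R :=
  inf [set r | code_norm_lt q (select t s) r].

Section Codes.
Context {V : normedModType R} (b : nat -> V).
Hypothesis db : dense (range b).

Let truncated_dist_lt (u v : V) (d : R) : d <= 1 ->
  (truncated_dist u v < d) = (`|u - v| < d).
Proof. by move=> d1; rewrite /truncated_dist gt_min [1 < d]ltNge d1 orbF. Qed.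

(** Positivity keeps all intermediate errors below [d <= 1], where truncation is invisible. *)
Let code_near_gt0 l j d : code_near (banach_code b) l j d -> 0 < d.
Proof.
have pos u v (e : rat) : truncated_dist (u : V) v < ratr e -> 0 < e.
  move=> H; rewrite -(ltr_rat R) rmorph0; apply: le_lt_trans H.
  by rewrite le_min normr_ge0 ler01.
elim: l j d => [|[c i] l IH] j d /=; first exact: pos.
case: (pselect (Num.min `|b i| 1 < 1)) => [/[dup] bi /[swap]|nbi] [H1 H2].
  move=> /H1[k [m [e [/pos e0 _ /pos]]]]; lra.
exact: IH (H2 nbi).
Qed.

Let dense_rat (u : V) (e : rat) : 0 < e -> exists i, `|u - b i| < ratr e.
Proof.
move=> e0; have [|i] := @dense_ball R V _ b u (ratr e) db.
  by rewrite -(rmorph0 (@ratr R)) ltr_rat.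
by rewrite ball_normrE => ?; exists i.
Qed.

Lemma code_nearP l j d : d <= 1 ->
  code_near (banach_code b) l j d <-> `|ratcomb l (clip b) - b j| < ratr d.
Proof.
have le1 (e : rat) : e <= 1 -> ratr e <= 1 :> R.
  by move=> ?; rewrite -(rmorph1 (@ratr R)) ler_rat.
elim: l j d => [|[c i] l IH] j d d1 /=.
  by rewrite truncated_dist_lt ?le1// /ratcomb big_nil.
rewrite ratcomb_cons /= gt_min ltxx orbF /clip.
have [bi|bi] := boolP (`|b i| < 1); last first.
  rewrite scaler0 add0r -IH//; split=> [[_]|H]; first exact.
  by split.
split=> [[/(_ isT)[k [m [e [H1 H2 H3]]]] _]|H].
  have e0 := code_near_gt0 H2.
  have e3 : 0 < d - e - e.
    rewrite -(ltr_rat R) rmorph0; apply: le_lt_trans H3.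
    by rewrite le_min normr_ge0 ler01.
  move: H1 H2 H3; rewrite !truncated_dist_lt ?IH ?le1//; [|lra..].
  rewrite !rmorphB /= => H1 H2 H3.
  set u := ratr c *: b i in H1 *; set v := ratcomb l _ in H2 *.
  have -> : u + v - b j = (u - b k) + (v - b m) + (b k + b m - b j).
    by rewrite [(u - b k) + _]addrACA -opprD addrA subrK.
  have := ler_normD (u - b k + (v - b m)) (b k + b m - b j).
  by have := ler_normD (u - b k) (v - b m); lra.
split=> // _; set u := ratr c *: b i in H; set v := ratcomb l _ in H.
(* Approximating [u] and [v] moves the sum by less than [2 * e], and another [2 * e] is lost in the
   bound [d - e - e]. *)
have : 0 < (ratr d - `|u + v - b j|) / 4 by rewrite divr_gt0// subr_gt0.
move=> /ratr_between[e /andP[e0 eH]].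
have e0' : 0 < e by rewrite -(ltr_rat R) rmorph0.
have [k uk] := dense_rat u e0'; have [m vm] := dense_rat v e0'.
exists k, m, e; rewrite -/u.
have ed : e <= d.
  by rewrite -(ler_rat R); have := normr_ge0 (u + v - b j); lra.
split.
- by rewrite truncated_dist_lt// le1//; lra.
- by apply/IH => //; lra.
rewrite truncated_dist_lt; last by apply: le1; lra.
rewrite !rmorphB /=.
have -> : b k + b m - b j = (u + v - b j) - ((u - b k) + (v - b m)).
  by rewrite [(u - b k) + _]addrACA -opprD opprB [RHS]addrC addrA subrK.
have := ler_normB (u + v - b j) ((u - b k) + (v - b m)).
by have := ler_normD (u - b k) (v - b m); lra.
Qed.

Lemma code_norm_ltP l r :
  code_norm_lt (banach_code b) l r <-> `|ratcomb l (clip b)| < r.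
Proof.
split=> [[j [n [d [e [d1 en der /(code_nearP _ _ d1) H1 /= H2]]]]]|H].
  move: H2; rewrite gt_min => /orP[H2|/lt_le_trans/(_ en)]; last by rewrite ltxx.
  apply: lt_le_trans der; rewrite rmorphD /=.
  by have := ler_normD (ratcomb l (clip b) - b j) (b j); rewrite subrK; lra.
set u := ratcomb l _ in H *.
(* A third of the gap leaves a rational [e] between [|u| + d] and [r - d]; the minimum with 1 is for
   the truncated distance. *)
have : 0 < Num.min 1 ((r - `|u|) / 3) by rewrite lt_min ltr01 divr_gt0// subr_gt0.
move=> /ratr_between[d /andP[d0]]; rewrite lt_min => /andP[d1 dr].
have d0' : 0 < d by rewrite -(ltr_rat R) rmorph0.
have [j uj] := dense_rat u d0'.
have : `|u| + ratr d < r - ratr d by lra.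
move=> /ratr_between[e /andP[ue er]].
exists j, (Num.truncn (ratr e : R)), d, e; split.
- by rewrite -(ler_rat R) rmorph1 ltW.
- by rewrite ltW// truncnS_gt.
- by rewrite rmorphD /=; lra.
- by apply/code_nearP => //; rewrite -(ler_rat R) rmorph1 ltW.
rewrite /= gt_min; apply/orP; left.
by have := ler_normD (b j - u) u; rewrite subrK distrC; lra.
Qed.

Lemma code_testE : code_test (banach_code b) = banach_test b.
Proof.
apply/funext => t; apply/funext => s; rewrite /code_test /banach_test.
set v := `|_|; rewrite (_ : [set r | _] = [set r | v < r]).
  by rewrite -set_itvoy inf_itv.
by apply/funext => r; apply/propext; exact: code_norm_ltP.
Qed.

End Codes.

Let sigma_borel : sigma_algebra [set: banach_codes R] borel := smallest_sigma_algebra _ _.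

Lemma borel_code_near l j d : borel [set q : banach_codes R | code_near (set_val q) l j d].
Proof.
elim: l j d => [|[c i] l IH] j d /=; first exact: borel_coordinate_lt.
apply: (sigma_algebra_and sigma_borel); apply: (sigma_algebra_imply sigma_borel).
- exact: borel_coordinate_lt.
- apply: (sigma_algebra_ex sigma_borel) => k; apply: (sigma_algebra_ex sigma_borel) => m.
  apply: (sigma_algebra_ex sigma_borel) => e.
  rewrite (_ : [set q | _] = [set q | set_val q (bscale c i k) < ratr e /\
      (code_near (set_val q) l m e /\ set_val q (badd k m j) < ratr (d - e - e))]).
    do 2 ?[apply: (sigma_algebra_and sigma_borel)] => //; exact: borel_coordinate_lt.
  by apply/seteqP; split=> q [] // ? []; split.
- by apply: (sigma_algebra_not sigma_borel); exact: borel_coordinate_lt.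
- exact: IH.
Qed.

Lemma borel_code_norm_lt l r : borel [set q : banach_codes R | code_norm_lt (set_val q) l r].
Proof.
apply: (sigma_algebra_ex sigma_borel) => j; apply: (sigma_algebra_ex sigma_borel) => n.
apply: (sigma_algebra_ex sigma_borel) => d; apply: (sigma_algebra_ex sigma_borel) => e.
rewrite (_ : [set q | _] = [set q : banach_codes R |
    [/\ d <= 1, ratr e <= n.+1%:R :> R & ratr (d + e) <= r] /\
    (code_near (set_val q) l j d /\ set_val q (bnorm n j) < ratr e)]).
  apply: (sigma_algebra_and sigma_borel); first exact: (sigma_algebra_cst sigma_borel).
  apply: (sigma_algebra_and sigma_borel); first exact: borel_code_near.
  exact: borel_coordinate_lt.
by apply/seteqP; split=> q [] // [? ? ?] []; split.
Qed.

End Tests.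

(** * Kadets distance *)

Section RationalCouplings.
Context {R : realType} {A B : normedModType R} (x : nat -> A) (y : nat -> B) (eps : R).
Hypotheses (eps0 : 0 < eps) (x1 : forall n, `|x n| <= 1) (y1 : forall n, `|y n| <= 1).
Hypothesis xy : forall l : seq (rat * nat),
  `| `|ratcomb l x| - `|ratcomb l y| | <= eps * banach_weight l.

Let rational_approx (l : seq (R * nat)) (d : R) : 0 < d ->
  exists l' : seq (rat * nat), [/\ `|lincomb l x - ratcomb l' x| <= d,
    `|lincomb l y - ratcomb l' y| <= d & banach_weight l' <= weight l + d].
Proof.
elim: l d => [|[c n] l IH] d d0.
  exists [::]; rewrite /lincomb /ratcomb /banach_weight /weight !big_nil !subrr !normr0 add0r.
  by split; exact: ltW.
have d20 : 0 < d / 2 by rewrite divr_gt0.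
have [l' [lx ly lw]] := IH _ d20.
have : c < c + d / 2 by rewrite ltrDl.
move=> /ratr_between[q /andP[cq qc]].
have cqd : `|c - ratr q| <= d / 2 by rewrite ler_norml; apply/andP; split; lra.
have step (V : normedModType R) (u : nat -> V) : `|u n| <= 1 ->
    `|lincomb l u - ratcomb l' u| <= d / 2 ->
    `|lincomb ((c, n) :: l) u - ratcomb ((q, n) :: l') u| <= d.
  move=> u1 lu; rewrite ratcomb_cons /lincomb big_cons -/(lincomb l u) /=.
  rewrite opprD addrACA -scalerBl (le_trans (ler_normD _ _))// [leRHS]splitr lerD//.
  by rewrite normrZ (le_trans _ cqd)// ler_piMr.
exists ((q, n) :: l'); split; [exact: step|exact: step|].
rewrite /banach_weight /weight !big_cons /= -/(banach_weight l') -/(weight l).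
have : `|ratr q : R| <= `|c| + d / 2.
  by have := ler_normB c (c - ratr q); rewrite subKr; lra.
by lra.
Qed.

Lemma rational_coupling_isometry (l : seq (R * nat)) :
  `| `|lincomb l x| - `|lincomb l y| | <= eps * weight l.
Proof.
(* Each of the two norms changes by at most [d] and the weight term by at most [eps * d], in total
   [e]. *)
apply/ler_addgt0Pr => e e0; pose d := e / (2 + eps).
have d0 : 0 < d by rewrite divr_gt0// addr_gt0.
have [l' [lx ly lw]] := rational_approx l d0.
have eE : e = d + d + eps * d by rewrite -mulr2n -mulr_natl -mulrDl mulrC divfK// gt_eqF// addr_gt0.
have : eps * banach_weight l' <= eps * weight l + eps * d by rewrite -mulrDr ler_pM2l.
have := xy l'; have := ler_dist_dist (lincomb l x) (ratcomb l' x).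
have := ler_dist_dist (lincomb l y) (ratcomb l' y).
rewrite !ler_norml => /andP[? ?] /andP[? ?] /andP[? ?] ?.
by apply/andP; split; lra.
Qed.

Definition rational_coupling : coupling A B :=
  Coupling eps0 x1 y1 rational_coupling_isometry.

End RationalCouplings.

Section BanachSpaces.
Context {R : realType}.

Lemma kadets_dist_eq0 (A B : completeNormedModType R) (a : nat -> A) (b : nat -> B) :
    dense (range a) -> dense (range b) ->
    (forall e : rat, 0 < e -> exists f g : nat -> nat,
      [/\ forall i, exists n, f n = i, forall j, exists n, g n = j &
        forall n, bf_close banach_weight stage0 (banach_test a) (banach_test b)
          (mkseq f n) (mkseq g n) e]) ->
  kadets_dist A B = 0%E.
Proof.
move=> da db H; apply: ereal_inf_eq0P.
  move=> _ [C [f1 [f2 [_ _ ->]]]]; apply: (@hausdorff_dist_ge0 _ _ _ _ (f1 0)).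
  by exists 0 => //; rewrite /unit_ball /= normr0 ler01.
(* Half of [e], because [d] serves both as mesh of the nets and as coupling constant. *)
move=> e e0; have /ratr_between[d /andP[d0 de]] : 0 < e / 2 by rewrite divr_gt0.
have [|f [g [fs gs fg]]] := H d; first by rewrite -(ltr_rat R) rmorph0.
pose x := clip a \o f; pose y := clip b \o g.
have xy (l : seq (rat * nat)) :
    `| `|ratcomb l x| - `|ratcomb l y| | <= ratr d * banach_weight l.
  (* [N] exceeds every index in [l], so [select] drops no term. *)
  pose N := (\max_(p <- l) p.2).+1.
  have lN p : p \in l -> (p.2 < N)%N by move=> pl; rewrite ltnS; exact: leq_bigmax_seq.
  have selectE h (V : normedModType R) (u : nat -> V) :
      ratcomb (select l (mkseq h N)) u = ratcomb l (u \o h).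
    rewrite /ratcomb /select big_map big_filter size_mkseq big_seq_cond [RHS]big_seq.
    apply: eq_big => [p|p /andP[pl pN]]; last by rewrite /= nth_mkseq.
    by apply: andb_idr => /lN.
  by have := fg N l; rewrite /banach_test !selectE.
have x1 n : `|x n| <= 1 by exact: norm_clip_le1.
have y1 n : `|y n| <= 1 by exact: norm_clip_le1.
have near (V : normedModType R) (c : nat -> V) h z : dense (range c) ->
    (forall i, exists n, h n = i) -> `|z| <= 1 ->
    exists n, `|z - (clip c \o h) n| < ratr d.
  move=> dc hs z1; have [i zi] := clip_dense dc z1 d0.
  by have [n hn] := hs i; exists n; rewrite /= hn.
have [|z z1|z z1|C [f1 [f2 [i1 i2 le_d]]]] :=
    @kadets_dist_le _ _ _ (rational_coupling d0 x1 y1 xy) (ratr d).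
- exact: d0.
- exact: near.
- exact: near.
exists (hausdorff_dist (f1 @` @unit_ball R A) (f2 @` @unit_ball R B)).
  by exists C, f1, f2.
by apply: le_trans le_d _; rewrite lee_fin /=; lra.
Qed.

Lemma kadets_dist_relation (A B : completeNormedModType R) (a : nat -> A) (b : nat -> B) :
    dense (range a) -> dense (range b) -> kadets_dist A B = 0%E ->
  forall e : rat, 0 < e -> exists E : nat -> nat -> Prop,
    [/\ forall i, exists j, E i j, forall j, exists i, E i j &
        forall s : seq (nat * nat), {in s, forall p, E p.1 p.2} ->
          bf_close banach_weight stage0 (banach_test a) (banach_test b)
            (unzip1 s) (unzip2 s) e].
Proof.
(* One half is for the Hausdorff distance, the other for the density of the clipped vectors. *)
move=> da db AB0 e e0; pose r : R := ratr e / 2.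
have r0 : 0 < r by rewrite divr_gt0 // -(rmorph0 (@ratr R)) ltr_rat.
have : (kadets_dist A B < r%:E)%E by rewrite AB0 lte_fin.
move=> /ereal_inf_lt[_ [C [f1 [f2 [i1 i2 ->]]]] fr].
exists (fun i j => `|f1 (clip a i) - f2 (clip b j)| <= ratr e); split.
- move=> i; have [|_ [y y1 <-]] := hausdorff_dist_lt (x := f1 (clip a i)) fr.
    by exists (clip a i) => //; exact: norm_clip_le1.
  rewrite ball_normrE => ay; have [j yj] := clip_dense db y1 r0.
  exists j; rewrite (le_trans (ler_distD (f2 y) _ _))// -raddfB i2.
  by move: ay yj; rewrite /r; lra.
- rewrite hausdorff_distC in fr.
  move=> j; have [|_ [x x1 <-]] := hausdorff_dist_lt (x := f2 (clip b j)) fr.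
    by exists (clip b j) => //; exact: norm_clip_le1.
  rewrite ball_normrE => bx; have [i xi] := clip_dense da x1 r0.
  exists i; rewrite distrC (le_trans (ler_distD (f1 x) _ _))// -raddfB i1.
  by move: bx xi; rewrite /r; lra.
move=> s sE t; rewrite /banach_test -i1 -i2.
(* By linearity the difference of the combinations is a combination of differences of related
   vectors, each of norm at most [ratr e]. *)
apply: le_trans (ler_dist_dist _ _) _; rewrite /ratcomb /select !raddf_sum /= !big_map !big_filter.
rewrite !size_map -big_split (le_trans (ler_norm_sum _ _ _))//.
rewrite /banach_weight mulr_sumr.
rewrite (le_trans _ (_ : \sum_(p <- t | (p.2 < size s)%N) ratr e * `|ratr p.1 : R| <= _))//.
  apply: ler_sum => p ps; rewrite !linearZ /= -scalerDr normrZ mulrC ler_wpM2r//.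
  rewrite /unzip1 /unzip2 !(nth_map (0, 0)%N)//.
  by apply: sE; exact: mem_nth.
rewrite big_mkcond; apply: ler_sum => p _; case: ifP => // _.
by rewrite mulr_ge0// -(rmorph0 (@ratr R)) ler_rat ltW.
Qed.

Theorem borel_kadets_eq0 (A : completeNormedModType R) : separable A ->
  borel [set q : banach_codes R | exists2 B : completeNormedModType R,
    codes_banach (set_val q) B & kadets_dist A B = 0%E].
Proof.
move=> sA; have [a da] := separable_dense_sequence (0 : A) sA.
have sB : sigma_algebra [set: banach_codes R] borel := smallest_sigma_algebra _ _.
have [|Y [SY Yl Yr]] := scott_set banach_weight_ge0 sB (banach_test a)
    (F := fun q : banach_codes R => code_test (set_val q)).
  (* Every [q] codes some space, so [code_test] is a norm there and its strict sublevel sets are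
     given by [code_norm_lt]. *)
  move=> t s r; rewrite (_ : [set q | _] =
      [set q : banach_codes R | code_norm_lt (set_val q) (select t s) r]).
    exact: borel_code_norm_lt.
  apply/funext => q; apply/propext.
  have /set_mem[B [_ [b /tail_dense_range db qb]]] : set_val q \in banach_codes R by exact: valP.
  rewrite /mkset qb code_testE//; apply: iff_sym; exact: code_norm_ltP.
rewrite (_ : [set q | _] = Y)//; apply/seteqP; split=> q.
  move=> [B [_ [b /tail_dense_range db qb]] AB0]; apply: Yl => e e0.
  by rewrite qb code_testE//; exact: kadets_dist_relation.
move=> /Yr Yq; have /set_mem[B qB] : set_val q \in banach_codes R by exact: valP.
exists B => //; case: qB => [_ [b /tail_dense_range db qb]].
by apply: (kadets_dist_eq0 da db) => e /Yq; rewrite qb code_testE.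
Qed.

End BanachSpaces.

Theorem corollary1p5 (R : realType) :
  (forall A : metricType R, polish_metric A -> diameter_le1 A ->
    borel [set p : metric_codes R | exists2 B : metricType R,
      codes_metric (set_val p) B & gromov_hausdorff_dist A B = 0%E]) /\
  (forall A : completeNormedModType R, separable A ->
    borel [set q : banach_codes R | exists2 B : completeNormedModType R,
      codes_banach (set_val q) B & kadets_dist A B = 0%E]).
Proof.
split; [exact: borel_gromov_hausdorff_eq0|exact: borel_kadets_eq0].
Qed.
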